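(* Let $\mathcal{H}$ be an infinite-dimensional separable Hilbert space, let $\{g_j\}_{j\in\Lambda}\subset\mathcal{H}$ be a Bessel sequence with Bessel bound $\beta>0$, and let $W$ be a closed subspace of $\mathcal{H}$. Let $(\mathcal{H},W,\mathscr{F},S)$ be a generalized non-uniform discrete dynamical system, and assume that $\mathscr{F}$ is linear (i.e. every $\mathscr{F}_\lambda$ is linear). Then each source term $w\in W$ can be stably recovered from the measurements $D(x_0,x_{-2},w)=[\langle x_\lambda,g_j\rangle]_{\lambda,j\in\Lambda}$ (in infinitely many time iterations) if and only if $\{S^*g_j\}_{j\in\Lambda}$ is a frame for $W$, where $S^*:\mathcal{H}\to W$ is the adjoint of $S:W\to\mathcal{H}$.
   Context: Let $N\in\mathbb{N}$, $N\ge1$, and let $r$ be a fixed odd integer coprime with $N$ with $1\le r\le 2N-1$. Put $\Lambda=\{0,\tfrac{r}{N}\}+2\mathbb{Z}\subset\mathbb{R}$. $\mathbb{Z}^+$ and $\mathbb{Z}^-$ denote the positive and negative integers. The Hilbert space $\mathcal{H}$ is real or complex with scalar field $\mathbb{F}\in\{\mathbb{R},\mathbb{C}\}$; all sequences and matrices have entries in $\mathbb{F}$. Limits as $|\lambda|\to\infty$ are over $\lambda\in\Lambda\subset\mathbb{R}$. Generalized non-uniform discrete dynamical system: for initial states $x_0,x_{-2}\in\mathcal{H}$ and a source term $w$ in the closed subspace $W$, the states $x_\lambda\in\mathcal{H}$ are given by the recursion $$x_\lambda=\begin{cases}\mathscr{F}_\lambda(x_0,x_{\frac rN},x_2,x_{2+\frac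 rN},\dots,x_{\lambda-2+\frac rN},w),&\lambda\in2\mathbb{Z}^+,\\ \mathscr{F}_\lambda(x_0,x_{\frac rN},x_2,x_{2+\frac rN},\dots,x_{\lambda-\frac rN},w),&\lambda\in(2\mathbb{Z}^++\frac rN)\cup\{\frac rN\},\\ \mathscr{F}_\lambda(x_{-2},x_{-2+\frac rN},x_{-4},x_{-4+\frac rN},\dots,x_{\lambda+2+\frac rN},w),&\lambda\in2\mathbb{Z}^-\setminus\{-2\},\\ \mathscr{F}_\lambda(x_{-2},x_{-2+\frac rN},x_{-4},x_{-4+\frac rN},\dots,x_{\lambda-\frac rN},w),&\lambda\in2\mathbb{Z}^-+\frac rN,\end{cases}$$ where each $\mathscr{F}_\lambda$ is a given $\mathcal{H}$-valued map of its arguments. It is denoted by $(\mathcal{H},W,\mathscr{F},S)$ if the following hold: (i) for each $w\in W$ there is a unique pair of stationary states, i.e. a unique pair of initial states $(x_0(w),x_{-2}(w))$ for which the resulting states with source $w$ satisfy $x_\lambda=\tfrac12(x_0(w)+x_{-2}(w))$ for all $\lambda\in\Lambda$; (ii) the map $S:W\to\mathcal{H}$, $S(w)=\tfrac12(x_0(w)+x_{-2}(w))$, is a bounded linear operator; (iii) for every $w\in W$ and arbitrary initial states $x_0,x_{-2}\in\mathcal{H}$, $\lim_{|\lambda|\to\infty}x_\lambda=S(w)$ in the norm of $\mathcal{H}$. Bessel sequence with Bessel bound $\beta$: $\sum_{j}|\langle f,g_j\rangle|^2\le\beta\|f\|^2$ for all $f\in\mathcal{H}$. A family $\{f_j\}_{j\in\Lambda}\subset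 W$ is a frame for $W$ if there are constants $\alpha_0,\beta_0>0$ with $\alpha_0\|f\|^2\le\sum_{j}|\langle f,f_j\rangle|^2\le\beta_0\|f\|^2$ for all $f\in W$. $\mathcal{B}(\ell^2(\Lambda),\ell^\infty(\Lambda))$ is the space of matrices $T=[a_{ij}]_{i,j\in\Lambda}$ whose rows $r_i=(a_{ij})_{j\in\Lambda}$ all belong to $\ell^2(\Lambda)$ with $\|T\|=\sup_{i\in\Lambda}\|r_i\|_{\ell^2(\Lambda)}<\infty$. $\mathcal{B}^{s}(\ell^2(\Lambda),\ell^\infty(\Lambda))$ is the subspace, with the induced norm, of those $T$ for which there is $z\in\ell^2(\Lambda)$ with $\lim_{|i|\to\infty}\|r_i-z\|_{\ell^2(\Lambda)}=0$. The data matrices $D(x_0,x_{-2},w)$ of such a system lie in $\mathcal{B}^{s}(\ell^2(\Lambda),\ell^\infty(\Lambda))$. The source terms $w\in W$ can be stably recovered in infinitely many time iterations if there is a bounded linear operator $\mathscr{R}:\mathcal{B}^{s}(\ell^2(\Lambda),\ell^\infty(\Lambda))\to\mathcal{H}$ such that $\mathscr{R}(D(x_0,x_{-2},w))=w$ for all $x_0,x_{-2}\in\mathcal{H}$ and all $w\in W$. *)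

(* Defs.v *)
From HB Require Import structures.
From mathcomp Require Import all_boot all_order all_algebra.
From mathcomp Require Import sesquilinear.
From mathcomp Require Import complex.
From mathcomp Require Import zify.
From mathcomp Require Import all_classical all_reals all_analysis.

Set Implicit Arguments.
Unset Strict Implicit.
Unset Printing Implicit Defensive.

Import Order.TTheory GRing.Theory Num.Theory.
Import numFieldNormedType.Exports.

Local Open Scope classical_set_scope.
Local Open Scope ring_scope.

Variant scalar_kind := RealScalars | ComplexScalars.

Definition scalar_field (R : realType) (s : scalar_kind) : numFieldType :=
  match s with
  | RealScalars => R
  | ComplexScalars => (R[i])%C
  end.

Definition sconj (R : realType) (s : scalar_kind) : scalar_field R s -> scalar_field R s :=
  match s with
  | RealScalars => fun x => x
  | ComplexScalars => fun x : R[i] => (x^*)%C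
  end.

Definition smod (R : realType) (s : scalar_kind) : scalar_field R s -> R :=
  match s with
  | RealScalars => fun x : R => `|x|
  | ComplexScalars => fun x : R[i] => complex.Re `|x|
  end.

(* The library norm of a normed space over [scalar_field R s] takes its values in
   [scalar_field R s]; [hnorm] is the same norm with values in [R]. *)
Definition hnorm (R : realType) (s : scalar_kind)
  (H : normedModType (scalar_field R s)) (x : H) : R := smod `|x|.

Definition infinite_dimensional (K : numFieldType) (H : lmodType K) : Prop :=
  ~ exists (n : nat) (v : 'I_n -> H),
      forall x : H, exists c : 'I_n -> K, x = \sum_(i < n) c i *: v i.

Definition separable_space (T : topologicalType) : Prop :=
  exists2 A : set T, countable A & dense A.

Definition closed_subspace (K : numFieldType) (H : normedModType K)
  (W : set H) : Prop :=
  [/\ closed W, W 0 &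
      forall (a : K) (u v : H), W u -> W v -> W (a *: u + v)].

Section IndexSet.
Variables (R : realType) (N r : nat).

Definition Lambda : set R :=
  [set l | exists k : int,
     l = (2 * k)%:~R \/ l = r%:R / N%:R + (2 * k)%:~R].

Definition fwd_val (n : nat) : R :=
  (odd n)%:R * (r%:R / N%:R) + (2 * (n./2)%:Z)%:~R.

Definition bwd_val (n : nat) : R :=
  (odd n)%:R * (r%:R / N%:R) + (2 * (- 1 - (n./2)%:Z))%:~R.

Lemma Lambda_shift (b : bool) (k : int) :
  b%:R * (r%:R / N%:R) + (2 * k)%:~R \in Lambda.
Proof.
rewrite inE; exists k; case: b; first by right; rewrite mul1r.
by left; rewrite mul0r add0r.
Qed.

(* 0, r/N, 2, 2 + r/N, 4, ... *)
Definition fwd (n : nat) : Lambda :=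
  exist (fun l => l \in Lambda) (fwd_val n) (Lambda_shift (odd n) _).

(* -2, -2 + r/N, -4, -4 + r/N, -6, ... *)
Definition bwd (n : nat) : Lambda :=
  exist (fun l => l \in Lambda) (bwd_val n) (Lambda_shift (odd n) _).

Definition Lambda_infty : set_system Lambda :=
  filter_from [set: R] (fun M => [set l : Lambda | M < `|val l|]).

End IndexSet.

Arguments Lambda : clear implicits.
Arguments fwd {R N r} n.
Arguments bwd {R N r} n.

Section IndexSetTheory.
Variables (R : realType) (N r : nat).
Lemma Lambda_enum (l : Lambda R N r) :
  (exists n, l = fwd n) \/ (exists n, l = bwd n).
Proof.
have [b [k E]] : exists (b : bool) (k : int),
    val l = b%:R * (r%:R / N%:R) + (2 * k)%:~R.
  case: l => l /= /[1!inE] -[k [->|->]].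
    by exists false, k; rewrite mul0r add0r.
  by exists true, k; rewrite mul1r.
case: k E => n E.
  left; exists (b + n.*2)%N; apply: val_inj; rewrite E /= /fwd_val.
  by rewrite oddD odd_double addbF oddb half_bit_double.
right; exists (b + n.*2)%N; apply: val_inj; rewrite E /= /bwd_val.
rewrite oddD odd_double addbF oddb half_bit_double; congr (_ + (2 * _)%:~R).
by lia.
Qed.

Hypotheses (N_gt0 : (0 < N)%N) (r_odd : odd r).

Lemma Lambda_val_inj (b b' : bool) (k k' : int) :
  b%:R * (r%:R / N%:R) + (2 * k)%:~R =
  b'%:R * (r%:R / N%:R) + (2 * k')%:~R :> R -> b = b' /\ k = k'.
Proof.
have N0 : N%:R != 0 :> R by rewrite pnatr_eq0 -lt0n.
have noteven (m : int) : r%:R / N%:R <> (2 * m)%:~R :> R.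
  move=> /(congr1 (fun x => x * N%:R)); rewrite divfK// => E.
  have {E} E : r%:Z = 2 * m * N%:Z.
    by apply/eqP; rewrite -(eqr_int R) intrM -!pmulrn E.
  by move: r_odd; rewrite -[r]/(absz r%:Z) E !abszM oddM oddM.
have inj2 : (2 * k)%:~R = (2 * k')%:~R :> R -> k = k'.
  by move=> /eqP; rewrite eqr_int => /eqP /mulfI; apply.
case: b b' => [] [] /=; rewrite ?mul1r ?mul0r ?add0r.
- by move=> /addrI /inj2.
- move=> E; case: (noteven (k' - k)).
  by rewrite mulrBr rmorphB /= -E addrK.
- move=> E; case: (noteven (k - k')).
  by rewrite mulrBr rmorphB /= E addrK.
- by move=> /inj2.
Qed.

Lemma fwd_inj : injective (@fwd R N r).
Proof.
move=> m n [] /Lambda_val_inj[E [E']].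
by rewrite -(odd_double_half m) E E' odd_double_half.
Qed.

Lemma bwd_inj : injective (@bwd R N r).
Proof.
move=> m n [] /Lambda_val_inj[E] /addrI /oppr_inj [E'].
by rewrite -(odd_double_half m) E E' odd_double_half.
Qed.

Lemma fwd_bwd (m n : nat) : @fwd R N r m <> @bwd R N r n.
Proof. by move=> [] /Lambda_val_inj[_]; lia. Qed.

End IndexSetTheory.

Section Systems.
Variables (R : realType) (s : scalar_kind) (N r : nat).
Local Notation K := (scalar_field R s).
Local Notation L := (Lambda R N r).
Variables (H : completeNormedModType K) (ip : {dot H for @sconj R s}).
Variable W : set H.

(* [F l n] stands for the map F_l of n previous states and the source; it is
   only ever used at the arity of F_l, i.e. for l = fwd n or l = bwd n. *)
Definition dynamics := L -> forall n : nat, {ffun 'I_n -> H} -> H -> H.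

(* Each of the four cases of the recursion lists, in order, the states that
   precede l in the enumeration fwd (if l >= 0) or bwd (if l < 0). *)
Definition states (F : dynamics) (x0 xm2 w : H) (x : L -> H) : Prop :=
  [/\ x (fwd 0) = x0, x (bwd 0) = xm2,
      forall n, (0 < n)%N ->
        x (fwd n) = F (fwd n) n [ffun i : 'I_n => x (fwd i)] w &
      forall n, (0 < n)%N ->
        x (bwd n) = F (bwd n) n [ffun i : 'I_n => x (bwd i)] w].

Lemma ex_recursion (x0 : H) (G : forall n : nat, {ffun 'I_n -> H} -> H) :
  exists2 y : nat -> H, y 0%N = x0 &
    forall n, (0 < n)%N -> y n = G n [ffun i : 'I_n => y i].
Proof.
pose fix l n := if n is m.+1 then
  rcons (l m) (G m.+1 [ffun i : 'I_m.+1 => nth 0 (l m) i]) else [:: x0].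
have sl n : size (l n) = n.+1 by elim: n => //= n IH; rewrite size_rcons IH.
have nl n i : (i <= n)%N -> nth 0 (l n) i = nth 0 (l i) i.
  elim: n => [|n IH]; first by rewrite leqn0 => /eqP ->.
  rewrite leq_eqVlt => /predU1P[->//|]; rewrite ltnS => le.
  by rewrite /= nth_rcons sl ltnS le IH.
exists (fun n => nth 0 (l n) n) => // -[//|n] _ /=.
rewrite nth_rcons sl ltnn eqxx; congr G; apply/ffunP => i; rewrite !ffunE.
by rewrite nl// -ltnS.
Qed.

Lemma states_exist_unique (N_gt0 : (0 < N)%N) (r_odd : odd r)
  (F : dynamics) (x0 xm2 w : H) : exists! x : L -> H, states F x0 xm2 w x.
Proof.
have [y y0 yS] := @ex_recursion x0 (fun n u => F (fwd n) n u w).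
have [z z0 zS] := @ex_recursion xm2 (fun n u => F (bwd n) n u w).
have [x xf xb] : exists2 x : L -> H,
    forall n, x (fwd n) = y n & forall n, x (bwd n) = z n.
  have /choice[x xP] : forall l : L, exists h : H,
      (forall n, l = fwd n -> h = y n) /\ (forall n, l = bwd n -> h = z n).
    move=> l; case: (Lambda_enum l) => -[m ->].
      exists (y m); split=> n; first by move=> /(fwd_inj N_gt0 r_odd) ->.
      by move=> /(fwd_bwd N_gt0 r_odd).
    exists (z m); split=> n; last by move=> /(bwd_inj N_gt0 r_odd) ->.
    by move=> /esym /(fwd_bwd N_gt0 r_odd).
  by exists x => n; [apply: (xP (fwd n)).1|apply: (xP (bwd n)).2].
exists x; split.
  split; rewrite ?xf ?xb// => n n0; rewrite ?xf ?xb ?yS ?zS//;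
    by congr F; apply/ffunP => i; rewrite !ffunE ?xf ?xb.
move=> x' [f0 b0 fS bS]; apply/funext => l.
case: (Lambda_enum l) => -[n ->]; rewrite ?xf ?xb.
  elim/ltn_ind: n => -[|n] IH; first by rewrite y0 f0.
  rewrite yS// fS//; congr F; apply/ffunP => i; rewrite !ffunE.
  by rewrite IH.
elim/ltn_ind: n => -[|n] IH; first by rewrite z0 b0.
rewrite zS// bS//; congr F; apply/ffunP => i; rewrite !ffunE.
by rewrite IH.
Qed.

Definition linear_map_on_source (n : nat) (f : {ffun 'I_n -> H} -> H -> H) :=
  forall (a : K) (u v : {ffun 'I_n -> H}) (w w' : H), W w -> W w' ->
    f (a *: u + v) (a *: w + w') = a *: f u w + f v w'.

Definition linear_dynamics (F : dynamics) : Prop :=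
  forall n, (0 < n)%N ->
    linear_map_on_source (F (fwd n) n) /\ linear_map_on_source (F (bwd n) n).

Definition average (p : H * H) : H := 2^-1 *: (p.1 + p.2).

Definition stationary (F : dynamics) (w : H) (p : H * H) : Prop :=
  states F p.1 p.2 w (fun=> average p).

Definition bounded_linear_on (S : H -> H) : Prop :=
  (forall (a : K) (w w' : H), W w -> W w' ->
     S (a *: w + w') = a *: S w + S w') /\
  (exists C : R, forall w, W w -> hnorm (S w) <= C * hnorm w).

(* S is only meaningful on W. *)
Definition gen_nonuniform_system (F : dynamics) (S : H -> H) : Prop :=
  [/\ forall w, W w -> exists! p : H * H, stationary F w p,
      forall w p, W w -> stationary F w p -> S w = average p,
      bounded_linear_on S &
      forall w x0 xm2 x, W w -> states F x0 xm2 w x ->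
        x l @[l --> @Lambda_infty R N r] --> S w].

(* S^* : H -> W; by the Riesz representation theorem the set below is a
   singleton when S is bounded on the closed subspace W. *)
Definition adjoint (S : H -> H) (h : H) : H :=
  xget 0 [set v | W v /\ forall w, W w -> ip (S w) h = ip w v].

Definition bessel_sum (g : L -> H) (f : H) : \bar R :=
  (\esum_(j in [set: L]) ((smod (ip f (g j)) ^+ 2)%:E))%E.

Definition bessel (g : L -> H) (beta : R) : Prop :=
  forall f : H, (bessel_sum g f <= (beta * hnorm f ^+ 2)%:E)%E.

Definition frame_for (f_ : L -> H) : Prop :=
  (forall j, W (f_ j)) /\
  exists alpha0 beta0 : R,
    [/\ 0 < alpha0, 0 < beta0 &
        forall f : H, W f ->
          ((alpha0 * hnorm f ^+ 2)%:E <= bessel_sum f_ f)%E /\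
          (bessel_sum f_ f <= (beta0 * hnorm f ^+ 2)%:E)%E].

Definition l2norm (z : L -> K) : \bar R :=
  ((\esum_(j in [set: L]) ((smod (z j) ^+ 2)%:E)) `^ (2^-1))%E.

Definition in_l2 (z : L -> K) : Prop := (l2norm z < +oo)%E.

Definition B_norm (T : L -> L -> K) : \bar R :=
  ereal_sup [set l2norm (T i) | i in [set: L]].

Definition in_B (T : L -> L -> K) : Prop :=
  (forall i, in_l2 (T i)) /\ (B_norm T < +oo)%E.

Definition in_Bs (T : L -> L -> K) : Prop :=
  in_B T /\
  exists2 z : L -> K, in_l2 z &
    l2norm (fun j => T i j - z j) @[i --> @Lambda_infty R N r] --> (0 : \bar R)%E.

Definition bounded_linear_on_Bs (Rec : (L -> L -> K) -> H) : Prop :=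
  (forall (a : K) (T T' : L -> L -> K), in_Bs T -> in_Bs T' ->
     Rec (fun i j => a * T i j + T' i j) = a *: Rec T + Rec T') /\
  (exists C : R, forall T, in_Bs T ->
     ((hnorm (Rec T))%:E <= C%:E * B_norm T)%E).

Definition data_matrix (g : L -> H) (x : L -> H) : L -> L -> K :=
  fun l j => ip (x l) (g j).

Definition stably_recoverable (F : dynamics) (g : L -> H) : Prop :=
  exists Rec : (L -> L -> K) -> H,
    bounded_linear_on_Bs Rec /\
    forall (x0 xm2 w : H) (x : L -> H), W w -> states F x0 xm2 w x ->
      Rec (data_matrix g x) = w.

End Systems.

(* Main.v *)
(** If Rec recovers the sources, then the stationary states x_l = S w produce a
    data matrix all of whose rows equal (<S w, g_j>)_j = (<w, S* g_j>)_j, so the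
    boundedness of Rec is a lower frame bound.  Conversely, the rows of any
    matrix in B^s converge to some z in l^2, and Rec maps the matrix to the
    least-squares solution w in W of <w, S* g_j> = z_j, which exists, is unique
    and is bounded in z by the frame inequalities. *)
Require Import Defs.
From HB Require Import structures.
From mathcomp Require Import all_boot all_order all_algebra.
From mathcomp Require Import sesquilinear complex ring lra.
From mathcomp Require Import all_classical all_reals all_analysis.

Set Implicit Arguments.
Unset Strict Implicit.
Unset Printing Implicit Defensive.

Import Order.TTheory GRing.Theory Num.Theory.
Import numFieldNormedType.Exports.

Local Open Scope classical_set_scope.
Local Open Scope ring_scope.

(** * Scalar identities and estimates, uniform in the real and complex cases *)

Section Scalars.
Variables (R : realType) (s : scalar_kind).
Local Notation K := (scalar_field R s).
Implicit Types (k l : K) (x y : R).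

Definition sreal : R -> K :=
  match s with RealScalars => id | ComplexScalars => real_complex R end.

Definition sre : K -> R :=
  match s with RealScalars => id | ComplexScalars => @complex.Re R end.

Lemma sre_sreal x : sre (sreal x) = x.
Proof. by rewrite /sre /sreal; case: s. Qed.

Lemma sreD k l : sre (k + l) = sre k + sre l.
Proof. by move: k l; rewrite /sre; case: s => //= -[a b] [c d]. Qed.

Lemma sreB k l : sre (k - l) = sre k - sre l.
Proof. by move: k l; rewrite /sre; case: s => //= -[a b] [c d]. Qed.

Lemma sreN k : sre (- k) = - sre k.
Proof. by move: k; rewrite /sre; case: s => //= -[a b]. Qed.

Lemma sre_conj k : sre (sconj k) = sre k.
Proof. by move: k; rewrite /sre; case: s => //= -[a b]. Qed.

Lemma sreM_sreal x k : sre (sreal x * k) = x * sre k.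
Proof.
move: k; rewrite /sre /sreal; case: s => //= -[a b] /=.
by rewrite mul0r subr0.
Qed.

Lemma normr_sreal k : `|k| = sreal (smod k).
Proof.
by move: k; rewrite /sreal /smod; case: s => //= k.
Qed.

Lemma srealX x n : sreal (x ^+ n) = sreal x ^+ n.
Proof. by rewrite /sreal; case: s => //=; rewrite rmorphXn. Qed.

Lemma sreal_lt x y : (sreal x < sreal y) = (x < y).
Proof. by rewrite /sreal; case: s => //=; rewrite ltcR. Qed.

Lemma sreal_le x y : (sreal x <= sreal y) = (x <= y).
Proof. by rewrite /sreal; case: s => //=; rewrite lecR. Qed.

Lemma srealM x y : sreal (x * y) = sreal x * sreal y.
Proof. by rewrite /sreal; case: s => //=; rewrite rmorphM. Qed.

Lemma srealD x y : sreal (x + y) = sreal x + sreal y.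
Proof. by rewrite /sreal; case: s => //=; rewrite rmorphD. Qed.

Lemma sreal1 : sreal 1 = 1.
Proof. by rewrite /sreal; case: s => //=; rewrite rmorph1. Qed.

Lemma sreal0 : sreal 0 = 0.
Proof. by rewrite /sreal; case: s => //=; rewrite rmorph0. Qed.

Lemma sreal_inj : injective sreal.
Proof. by move=> x y /(congr1 sre); rewrite !sre_sreal. Qed.

Lemma pos_sreal k : 0 < k -> exists2 x, 0 < x & k = sreal x.
Proof.
move=> k0; exists (smod k); rewrite -?normr_sreal ?gtr0_norm//.
by rewrite -sreal_lt -normr_sreal sreal0 gtr0_norm.
Qed.

Lemma smod_ge0 k : 0 <= smod k.
Proof. by rewrite -sreal_le -normr_sreal sreal0. Qed.

Lemma smodM k l : smod (k * l) = smod k * smod l.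
Proof. by apply: sreal_inj; rewrite srealM -!normr_sreal normrM. Qed.

Lemma smod_eq0 k : (smod k == 0) = (k == 0).
Proof. by rewrite -(inj_eq sreal_inj) sreal0 -normr_sreal normr_eq0. Qed.

Lemma sreM_conj k : sre (sconj k * k) = smod k ^+ 2.
Proof.
move: k; rewrite /sre /sconj /smod; case: s => /= [k|[a b]].
  by rewrite real_normK ?num_real// expr2.
by rewrite /= sqr_sqrtr ?addr_ge0 ?sqr_ge0//; ring.
Qed.

(** Expansion of a square with the cross term [2 x Re(k conj(l))] written by polarization.
    Everything stays in squared moduli, so the identity can be summed over an index set without
    introducing an inner product on l^2. *)
Lemma smod_sqr_comb k l (x : R) : smod (k + sreal x * l) ^+ 2
  = smod k ^+ 2 + x / 2 * (smod (k + l) ^+ 2 - smod (k - l) ^+ 2)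
    + x ^+ 2 * smod l ^+ 2.
Proof.
move: k l; rewrite /smod /sreal; case: s => /= [k l|[a b] [c d] /=].
  by rewrite !real_normK ?num_real//; field.
by rewrite !sqr_sqrtr ?addr_ge0 ?sqr_ge0//; field.
Qed.

Lemma smod_parallelogram k l :
  smod (k + l) ^+ 2 + smod (k - l) ^+ 2 = 2 * smod k ^+ 2 + 2 * smod l ^+ 2.
Proof.
move: k l; rewrite /smod; case: s => /= [k l|[a b] [c d] /=].
  by rewrite !real_normK ?num_real//; ring.
by rewrite !sqr_sqrtr ?addr_ge0 ?sqr_ge0//; ring.
Qed.

(** Polarized form of [Re((e + e') conj(u)) = Re(e conj(u)) + Re(e' conj(u))], with the negative
    terms moved across so that both sides are sums of nonnegative terms. *)
Lemma smod_sqr_additive (e e' u : K) :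
  smod (e + e' + u) ^+ 2 + (smod (e - u) ^+ 2 + smod (e' - u) ^+ 2) =
  smod (e + e' - u) ^+ 2 + (smod (e + u) ^+ 2 + smod (e' + u) ^+ 2).
Proof.
move: e e' u; rewrite /smod; case: s => /= [a b c|[a b] [c d] [e f] /=].
  by rewrite !real_normK ?num_real//; ring.
by rewrite !sqr_sqrtr ?addr_ge0 ?sqr_ge0//; ring.
Qed.

Lemma smodN k : smod (- k) = smod k.
Proof. by apply: sreal_inj; rewrite -!normr_sreal normrN. Qed.

(** Young's inequality. A small [x] keeps the weight of the first square close to 1, which the lower
    semicontinuity of the least-squares functional requires. *)
Lemma smodD_sqr_le k l x : 0 < x ->
  smod (k + l) ^+ 2 <= (1 + x) * smod k ^+ 2 + (1 + x^-1) * smod l ^+ 2.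
Proof.
move=> x0.
have h (a b : R) : (a + b) ^+ 2 <= (1 + x) * a ^+ 2 + (1 + x^-1) * b ^+ 2.
  rewrite -subr_ge0; suff -> : (1 + x) * a ^+ 2 + (1 + x^-1) * b ^+ 2 -
    (a + b) ^+ 2 = x^-1 * (x * a - b) ^+ 2.
    by rewrite mulr_ge0 ?sqr_ge0// invr_ge0 ltW.
  by field; rewrite gt_eqF.
apply: le_trans (h _ _); rewrite lerXn2r ?nnegrE ?addr_ge0 ?smod_ge0//.
by rewrite -sreal_le srealD -!normr_sreal ler_normD.
Qed.

End Scalars.
Arguments sreal {R} s x.

(** * Unordered sums of nonnegative reals *)

Section NonnegativeSums.
Variables (R : realType) (T : choiceType).
Implicit Types (f g : T -> R) (c : R).

Definition summable_ge0 f : Prop :=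
  (forall j, 0 <= f j) /\ (\esum_(j in [set: T]) (f j)%:E < +oo)%E.

(** [fine] sends an infinite sum to 0, so this value is the sum only under [summable_ge0]. *)
Definition rsum f : R := fine (\esum_(j in [set: T]) (f j)%:E)%E.

Lemma rsumE f : summable_ge0 f ->
  (\esum_(j in [set: T]) (f j)%:E = (rsum f)%:E)%E.
Proof.
move=> [f0 foo]; rewrite /rsum fineK// ge0_fin_numE//.
by apply: esum_ge0 => j _; rewrite lee_fin.
Qed.

Lemma rsum_ge0 f : (forall j, 0 <= f j) -> 0 <= rsum f.
Proof. by move=> f0; apply/fine_ge0/esum_ge0 => j _; rewrite lee_fin. Qed.

Lemma summable_ge0D f g : summable_ge0 f -> summable_ge0 g ->
  summable_ge0 (fun j => f j + g j) /\
  rsum (fun j => f j + g j) = rsum f + rsum g.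
Proof.
move=> sf sg.
have E : (\esum_(j in [set: T]) (f j + g j)%:E = (rsum f + rsum g)%:E)%E.
  under eq_esum do rewrite EFinD.
  rewrite esumD ?rsumE// => j _; rewrite lee_fin; [exact: sf.1|exact: sg.1].
split; last by rewrite [LHS]/rsum E.
by split=> [j|]; rewrite ?addr_ge0 ?E ?ltry//; [exact: sf.1|exact: sg.1].
Qed.

Lemma le_summable_ge0 f g : (forall j, 0 <= f j) -> (forall j, f j <= g j) ->
  summable_ge0 g -> summable_ge0 f /\ rsum f <= rsum g.
Proof.
move=> f0 fg sg.
have le : (\esum_(j in [set: T]) (f j)%:E <= \esum_(j in [set: T]) (g j)%:E)%E.
  by apply: le_esum => j _; rewrite lee_fin.
have sf : summable_ge0 f by split=> //; apply: le_lt_trans le sg.2.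
by split=> //; rewrite -lee_fin -!rsumE.
Qed.

Lemma esum_scale_le c f : 0 <= c -> summable_ge0 f ->
  (\esum_(j in [set: T]) (c * f j)%:E <= (c * rsum f)%:E)%E.
Proof.
move=> c0 sf; apply: ge_ereal_sup => _ [X [finX _]] <-.
rewrite fsumEFin// lee_fin -mulr_fsumr ler_wpM2l// -lee_fin -fsumEFin// -rsumE//.
by apply: esum_ge; exists X.
Qed.

Lemma summable_ge0Z c f : 0 <= c -> summable_ge0 f ->
  summable_ge0 (fun j => c * f j) /\ rsum (fun j => c * f j) = c * rsum f.
Proof.
move=> c0 sf.
have scf : summable_ge0 (fun j => c * f j).
  split=> [j|]; first by rewrite mulr_ge0//; exact: sf.1.
  exact: le_lt_trans (esum_scale_le c0 sf) (ltry _).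
split=> //; apply/eqP; rewrite eq_le -lee_fin -rsumE// esum_scale_le//=.
have [->|cN0] := eqVneq c 0.
  by rewrite mul0r rsum_ge0// => j; rewrite mul0r.
have {cN0}c0 : 0 < c by rewrite lt_neqAle eq_sym cN0.
(* The reverse inequality is the same bound for the factor [c^-1] and the family [c * f j]. *)
rewrite -ler_pdivlMl// -lee_fin; apply: le_trans (esum_scale_le _ scf).
  rewrite -rsumE//; apply: le_esum => j _.
  by rewrite mulrA mulVf ?gt_eqF// mul1r.
by rewrite invr_ge0 ltW.
Qed.

End NonnegativeSums.

(** * Square-summable families and orthogonality without an inner product *)

Section SquareSums.
Variables (R : realType) (s : scalar_kind) (T : choiceType).
Local Notation K := (scalar_field R s).
Implicit Types (x y z e u : T -> K).

Definition sq z (j : T) : R := smod (z j) ^+ 2.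
Definition l2 z : Prop := summable_ge0 (sq z).
Definition l2sq z : R := rsum (sq z).

Lemma sq_ge0 z j : 0 <= sq z j.
Proof. exact: sqr_ge0. Qed.

Lemma l2sq_ge0 z : 0 <= l2sq z.
Proof. by apply: rsum_ge0 => j; exact: sq_ge0. Qed.

Lemma l2Z (a : K) z : l2 z ->
  l2 (fun j => a * z j) /\ l2sq (fun j => a * z j) = smod a ^+ 2 * l2sq z.
Proof.
move=> /(summable_ge0Z (sqr_ge0 (smod a))).
by rewrite /l2 /l2sq (_ : sq (fun j => a * z j) = fun j => smod a ^+ 2 * sq z j)//;
  apply/funext => j; rewrite /sq smodM exprMn.
Qed.

Lemma l2N z : l2 z -> l2 (\- z) /\ l2sq (\- z) = l2sq z.
Proof.
rewrite /l2 /l2sq (_ : sq (\- z) = sq z)//.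
by apply/funext => j; rewrite /sq /= smodN.
Qed.

Lemma l2D x y : l2 x -> l2 y -> l2 (x \+ y) /\
  forall t, 0 < t -> l2sq (x \+ y) <= (1 + t) * l2sq x + (1 + t^-1) * l2sq y.
Proof.
move=> lx ly.
have le t : 0 < t -> l2 (x \+ y) /\
    l2sq (x \+ y) <= (1 + t) * l2sq x + (1 + t^-1) * l2sq y.
  move=> t0; have ti0 : 0 < t^-1 by rewrite invr_gt0.
  have [sx <-] := summable_ge0Z (addr_ge0 ler01 (ltW t0)) lx.
  have [sy <-] := summable_ge0Z (addr_ge0 ler01 (ltW ti0)) ly.
  have [sxy <-] := summable_ge0D sx sy.
  apply: le_summable_ge0 sxy => j; first exact: sq_ge0.
  exact: smodD_sqr_le.
by split=> [|t t0]; [have [] := le _ ltr01 | have [] := le _ t0].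
Qed.

Lemma l2B x y : l2 x -> l2 y -> l2 (x \- y) /\
  forall t, 0 < t -> l2sq (x \- y) <= (1 + t) * l2sq x + (1 + t^-1) * l2sq y.
Proof. by move=> lx /l2N[ly <-]; exact: l2D. Qed.

Lemma l2sq_parallelogram x y : l2 x -> l2 y ->
  l2sq (x \+ y) + l2sq (x \- y) = 2 * l2sq x + 2 * l2sq y.
Proof.
move=> lx ly; have [lD _] := l2D lx ly; have [lB _] := l2B lx ly.
have [sx <-] := summable_ge0Z (ler0n R 2) lx.
have [sy <-] := summable_ge0Z (ler0n R 2) ly.
rewrite /l2sq -(summable_ge0D lD lB).2 -(summable_ge0D sx sy).2.
by congr rsum; apply/funext => j; exact: smod_parallelogram.
Qed.

(** The squared norm along a line is quadratic in [t]; its linear coefficient is polarized and the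
    subtracted half stands on the left, so only nonnegative families are summed. *)
Lemma l2sq_line x y t : 0 <= t -> l2 x -> l2 y ->
  l2sq (fun j => x j + sreal s t * y j) + t / 2 * l2sq (x \- y) =
  l2sq x + (t / 2 * l2sq (x \+ y) + t ^+ 2 * l2sq y).
Proof.
move=> t0 lx ly; have [lD _] := l2D lx ly; have [lB _] := l2B lx ly.
have [lt _] := l2D lx (l2Z (sreal s t) ly).1.
have t20 : 0 <= t / 2 by rewrite divr_ge0.
have [sD <-] := summable_ge0Z t20 lD.
have [sB <-] := summable_ge0Z t20 lB.
have [sy <-] := summable_ge0Z (sqr_ge0 t) ly.
rewrite /l2sq -(summable_ge0D sD sy).2 -(summable_ge0D lt sB).2.
rewrite -(summable_ge0D lx (summable_ge0D sD sy).1).2.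
by congr rsum; apply/funext => j; rewrite /sq smod_sqr_comb /=; ring.
Qed.

(* The real part of the inner product of e and u vanishes; for u running
   through a K-subspace this is orthogonality to that subspace. *)
Definition l2orth e u : Prop := l2sq (e \+ u) = l2sq (e \- u).

Lemma l2orthD e e' u : l2 e -> l2 e' -> l2 u ->
  l2orth e u -> l2orth e' u -> l2orth (e \+ e') u.
Proof.
move=> le le' lu; have [lee _] := l2D le le'.
have [lD _] := l2D le lu; have [lB _] := l2B le lu.
have [lD' _] := l2D le' lu; have [lB' _] := l2B le' lu.
have [lDD _] := l2D lee lu; have [lBB _] := l2B lee lu.
rewrite /l2orth => E E'.
have : l2sq (e \+ e' \+ u) + (l2sq (e \- u) + l2sq (e' \- u)) =
       l2sq (e \+ e' \- u) + (l2sq (e \+ u) + l2sq (e' \+ u)).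
  have [sB E1] := summable_ge0D lB lB'; have [sD E2] := summable_ge0D lD lD'.
  rewrite /l2sq -E1 -E2 -(summable_ge0D lDD sB).2 -(summable_ge0D lBB sD).2.
  by congr rsum; apply/funext => j; exact: smod_sqr_additive.
by rewrite E E' => /addIr.
Qed.

(** For nonzero [a], the families [a e + u] and [a e - u] are [a] times [e + a^-1 u] and
    [e - a^-1 u], and [l2sq] scales by [smod a ^+ 2]. For [a = 0] the claim is that [u] and [- u]
    have the same norm. *)
Lemma l2orthZ a e u : l2 e -> l2 u ->
  l2orth e (fun j => a^-1 * u j) -> l2orth (fun j => a * e j) u.
Proof.
move=> le lu; have [-> _|a0] := eqVneq a 0.
  have : l2sq (\- u) = l2sq u := (l2N lu).2.
  by rewrite /l2orth => /esym; congr (_ = _); congr l2sq; apply/funext => j /=;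
     rewrite mul0r add0r.
have [lau _] := l2Z a^-1 lu.
have [lD _] := l2D le lau; have [lB _] := l2B le lau.
rewrite /l2orth => /(congr1 (fun c => smod a ^+ 2 * c)).
rewrite -(l2Z a lD).2 -(l2Z a lB).2.
by congr (_ = _); congr l2sq; apply/funext => j /=;
   rewrite ?mulrDr ?mulrN mulrA divff// mul1r.
Qed.

Lemma l2orth_pythagoras e u : l2 e -> l2 u -> l2orth e u ->
  l2sq (e \+ u) = l2sq e + l2sq u.
Proof. by move=> le lu eu; have := l2sq_parallelogram le lu; rewrite -eu; lra. Qed.

(** First-order condition at a minimum: the one-sided derivatives along [u] and [- u] are
    nonnegative, which gives the two inequalities of the equality. *)
Lemma l2orth_of_min e u : l2 e -> l2 u ->
  (forall a : K, l2sq e <= l2sq (fun j => e j + a * u j)) -> l2orth e u.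
Proof.
move=> le + minu.
have half v : l2 v -> (forall t, l2sq e <= l2sq (fun j => e j + sreal s t * v j)) ->
    l2sq (e \- v) <= l2sq (e \+ v).
  move=> lv minv; apply/ler_addgt0Pr => d d0.
  (* Dividing the minimality inequality by [t / 2] leaves the error [2 t l2sq v]; this [t] makes it
     at most [d]. *)
  pose t := d / (2 * (l2sq v + 1)).
  have v1 : 0 < l2sq v + 1 by rewrite ltr_wpDl// l2sq_ge0.
  have t0 : 0 < t by rewrite divr_gt0// mulr_gt0.
  have := l2sq_line (ltW t0) le lv; have := minv t.
  move=> /[swap] E; rewrite -subr_ge0 => m.
  have {E}m : 0 <= t / 2 * (l2sq (e \+ v) + 2 * t * l2sq v - l2sq (e \- v)).
    by move: m; congr (0 <= _); move: E; lra.
  have {}m : 0 <= l2sq (e \+ v) + 2 * t * l2sq v - l2sq (e \- v).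
    by move: m; rewrite pmulr_rge0// divr_gt0.
  have : 2 * t * l2sq v <= d.
    rewrite /t -[leRHS]mulr1 (_ : _ * _ = d * (l2sq v / (l2sq v + 1))).
      by rewrite ler_pM2l// ler_pdivrMr// mul1r lerDl.
    by field; rewrite gt_eqF.
  lra.
move=> lu; apply/eqP; rewrite eq_le; apply/andP; split; last first.
  by apply: half => // t; exact: minu.
have [lN _] := l2N lu.
have := half _ lN; rewrite (_ : e \- \- u = e \+ u); last first.
  by apply/funext => j /=; rewrite opprK.
apply=> t; have := minu (- sreal s t).
by congr (_ <= _); congr l2sq; apply/funext => j /=; rewrite mulrN mulNr.
Qed.

End SquareSums.

(** * The real-valued norm *)

Section Norm.
Variables (R : realType) (s : scalar_kind).
Local Notation K := (scalar_field R s).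
Variable (H : normedModType K).
Implicit Types (x y : H).

Lemma normr_hnorm x : `|x| = sreal s (hnorm x).
Proof. by rewrite /hnorm -normr_sreal normr_id. Qed.

Lemma hnorm_ge0 x : 0 <= hnorm x.
Proof. exact: smod_ge0. Qed.

Lemma hnorm_eq0 x : hnorm x = 0 -> x = 0.
Proof.
by move=> x0; apply/eqP; rewrite -normr_eq0 normr_hnorm x0 sreal0.
Qed.

Lemma hnorm_opp x : hnorm (- x) = hnorm x.
Proof. by rewrite /hnorm normrN. Qed.

Lemma hnorm_scale (a : K) x : hnorm (a *: x) = smod a * hnorm x.
Proof.
by apply: (@sreal_inj R s); rewrite srealM -!normr_hnorm -normr_sreal normrZ.
Qed.

Lemma ler_hnormD x y : hnorm (x + y) <= hnorm x + hnorm y.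
Proof. by rewrite -(sreal_le s) srealD -!normr_hnorm ler_normD. Qed.

Lemma ball_hnorm x y (e : R) : ball x (sreal s e) y = (hnorm (x - y) < e) :> Prop.
Proof. by rewrite -ball_normE /ball_ /= normr_hnorm sreal_lt. Qed.

Lemma cvg_hnorm (U : Type) (F : set_system U) {FF : Filter F} (f : U -> H) (l : H) :
  (f @ F --> l) -> forall e : R, 0 < e -> \forall t \near F, hnorm (l - f t) < e.
Proof.
move=> fl e e0; have : 0 < sreal s e by rewrite -(sreal0 R s) sreal_lt.
by move: fl => /cvgr_dist_lt /[apply]; apply: filterS => t; rewrite normr_hnorm sreal_lt.
Qed.

End Norm.

(** * Minimizing strongly convex functionals over a closed subspace *)

Section Minimization.
Variables (R : realType) (s : scalar_kind).
Local Notation K := (scalar_field R s).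
Variables (H : completeNormedModType K) (W : set H).
Hypothesis hW : closed_subspace W.

Lemma subspaceD u v : W u -> W v -> W (u + v).
Proof. by case: hW => _ _ W1 Wu Wv; have := W1 1 _ _ Wu Wv; rewrite scale1r. Qed.

Lemma subspaceZ (a : K) u : W u -> W (a *: u).
Proof. by case: hW => _ W0 W1 Wu; have := W1 a _ _ Wu W0; rewrite addr0. Qed.

Lemma subspaceN u : W u -> W (- u).
Proof. by rewrite -scaleN1r; exact: subspaceZ. Qed.

Lemma subspaceB u v : W u -> W v -> W (u - v).
Proof. by move=> Wu /subspaceN; exact: subspaceD. Qed.

(** The direct method, serving both Riesz representation and least squares: strong midpoint
    convexity makes near-minimizers Cauchy, completeness and closedness of [W] give a limit in [W],
    and lower semicontinuity makes it a minimizer. *)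
Lemma exists_minimizer (J : H -> R) (a m : R) : 0 < a ->
  (forall x, W x -> m <= J x) ->
  (forall x y, W x -> W y ->
     a * hnorm (x - y) ^+ 2 + 2 * J (2^-1 *: (x + y)) <= J x + J y) ->
  (forall x (e : R), W x -> 0 < e -> exists2 d : R, 0 < d &
     forall y, W y -> hnorm (x - y) < d -> J x <= J y + e) ->
  exists2 v, W v & forall w, W w -> J v <= J w.
Proof.
move=> a0 mJ cvxJ lscJ; have [clW W0 _] := hW.
pose I := inf (J @` W).
have hinf : has_inf (J @` W).
  by split; [exists (J 0), 0|exists m => _ [x Wx <-]; exact: mJ].
have IJ x : W x -> I <= J x.
  by move=> Wx; apply: ge_inf; [exact: hinf.2|exists x].
pose B (e : R) := [set x | W x /\ J x < I + e].
have Bn0 e : 0 < e -> exists x, B e x.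
  by move=> /inf_adherent /(_ hinf)[_ [x Wx <-] lt]; exists x.
(* The filter generated by the near-minimal sets plays the role of a minimizing sequence. *)
pose F := filter_from [set e : R | 0 < e] B.
have FF : ProperFilter F.
  apply: filter_from_proper => //; apply: filter_from_filter; first by exists 1 => /=.
  move=> e d /= e0 d0; exists (Num.min e d); first by rewrite /= lt_min e0.
  move=> x [Wx Jx]; split; split=> //; apply: lt_le_trans Jx _;
    by rewrite lerD2l ge_min lexx ?orbT.
have FW : F W by exists 1 => //= x [].
have : cauchy F.
  apply: cauchy_exP => _ /pos_sreal[e e0 ->].
  (* If [J x] and [J y] are below [I + d] while [J] at the midpoint is at least [I], convexity gives
     [a * hnorm (x - y) ^+ 2 < 2 d], and [2 d = a * e ^+ 2]. *)
  pose d := a * e ^+ 2 / 2.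
  have d0 : 0 < d by rewrite divr_gt0// mulr_gt0// exprn_gt0.
  have [x [Wx Jx]] := Bn0 d d0; exists x; exists d => // y [Wy Jy].
  rewrite ball_hnorm -(@ltr_pXn2r _ 2)// ?nnegrE ?hnorm_ge0 ?(ltW e0)//.
  have := cvxJ x y Wx Wy.
  have := IJ _ (subspaceZ 2^-1 (subspaceD Wx Wy)).
  rewrite -(ltr_pM2l a0); move: Jx Jy; rewrite /d; lra.
move=> /cauchy_cvg Fv; pose v := lim F.
have Wv : W v.
  by move: Fv; apply: (@closed_cvg _ _ F FF id W clW FW).
exists v => // w Ww; apply: le_trans (IJ w Ww); apply/ler_addgt0Pr => e e0.
have e20 : 0 < e / 2 by rewrite divr_gt0.
have [d d0 dJ] := lscJ v (e / 2) Wv e20.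
have /filter_ex[y [[Wy Jy] vy]] : F (B (e / 2) `&` [set y | hnorm (v - y) < d]).
  apply: filterI; first by exists (e / 2).
  exact: (@cvg_hnorm R s H H F _ id v Fv d d0).
have := dJ y Wy vy; lra.
Qed.

End Minimization.

(** * Inner product identities and Riesz representation on a subspace *)

Section InnerProduct.
Variables (R : realType) (s : scalar_kind).
Local Notation K := (scalar_field R s).
Variables (H : completeNormedModType K) (ip : {dot H for @sconj R s}).
Hypothesis hip : forall x : H, ip x x = `|x| ^+ 2.
Implicit Types (x y u v w : H).

Lemma ipC x y : ip x y = sconj (ip y x).
Proof. by rewrite [LHS]hermitian_subproof expr0 mul1r. Qed.

Lemma sre_ipC x y : sre (ip x y) = sre (ip y x).
Proof. by rewrite ipC sre_conj. Qed.

Lemma sre_ipxx x : sre (ip x x) = hnorm x ^+ 2.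
Proof. by rewrite hip normr_hnorm -srealX sre_sreal. Qed.

Lemma hnorm_sqrD x y :
  hnorm (x + y) ^+ 2 = hnorm x ^+ 2 + 2 * sre (ip x y) + hnorm y ^+ 2.
Proof.
rewrite -!sre_ipxx linearDl linearDr linearDr !sreD (sre_ipC y x); ring.
Qed.

Lemma sre_ip_le x y : sre (ip x y) <= hnorm x * hnorm y.
Proof.
have : hnorm (x + y) ^+ 2 <= (hnorm x + hnorm y) ^+ 2.
  by rewrite lerXn2r ?nnegrE ?addr_ge0 ?hnorm_ge0// ler_hnormD.
rewrite hnorm_sqrD; lra.
Qed.

Lemma hnorm_parallelogram x y :
  hnorm (x + y) ^+ 2 + hnorm (x - y) ^+ 2 = 2 * hnorm x ^+ 2 + 2 * hnorm y ^+ 2.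
Proof.
rewrite !hnorm_sqrD hnorm_opp linearNr sreN; ring.
Qed.

Lemma half_sreal : 2^-1 = sreal s 2^-1 :> K.
Proof.
apply: (@mulfI _ (2 : K)); first by rewrite pnatr_eq0.
rewrite mulfV ?pnatr_eq0// -[2 : K]/(1 + 1) -(sreal1 R s) -srealD -srealM.
by rewrite mulfV// pnatr_eq0.
Qed.

Lemma smod_half : smod (2^-1 : K) = 2^-1.
Proof.
by apply: (@sreal_inj R s); rewrite -normr_sreal -half_sreal ger0_norm ?invr_ge0 ?ler0n.
Qed.

Variable W : set H.
Hypothesis hW : closed_subspace W.

(* The representing vector minimizes |w|^2 - 2 Re (phi w) over W. *)
Lemma riesz_subspace (phi : H -> K) (C : R) :
  (forall (a : K) x y, W x -> W y -> phi (a *: x + y) = a * phi x + phi y) ->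
  (forall x, W x -> sre (phi x) <= C * hnorm x) ->
  exists2 v, W v & forall w, W w -> phi w = ip w v.
Proof.
move=> linphi; wlog C0 : C / 0 <= C => [wl|] phiC.
  apply: (wl `|C|) => // x Wx; apply: le_trans (phiC x Wx) _.
  by rewrite ler_wpM2r ?hnorm_ge0// ler_norm.
have [_ W0 _] := hW.
have phi0 : phi 0 = 0.
  by apply: (addrI (phi 0)); rewrite addr0 -{1}[phi 0]mul1r -linphi// scale1r addr0.
have phiZ a x : W x -> phi (a *: x) = a * phi x.
  by move=> Wx; rewrite -[a *: x]addr0 linphi// phi0 addr0.
have phiD x y : W x -> W y -> phi (x + y) = phi x + phi y.
  by move=> Wx Wy; rewrite -{1}[x]scale1r linphi// mul1r.
pose J x := hnorm x ^+ 2 - 2 * sre (phi x).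
(* By the parallelogram law the convexity condition with modulus 1/2 is an equality; the lower bound
   [- C ^+ 2] comes from completing the square. *)
have [||||v Wv minv] := @exists_minimizer R s H W hW J 2^-1 (- C ^+ 2).
- by rewrite invr_gt0.
- move=> x Wx; rewrite /J.
  have : 0 <= (hnorm x - C) ^+ 2 by exact: sqr_ge0.
  have := phiC x Wx; lra.
- move=> x y Wx Wy; have := hnorm_parallelogram x y.
  rewrite /J phiZ; last exact: (subspaceD hW).
  rewrite hnorm_scale smod_half exprMn half_sreal sreM_sreal.
  by rewrite phiD// sreD; lra.
- move=> x e Wx e0.
  (* [J x - J y] is at most [(2 hnorm x + 2 C) hnorm (x - y)]; the added 1 makes the divisor
     positive. *)
  have c0 : 0 < 2 * hnorm x + 2 * C + 1.
    by rewrite ltr_wpDl// addr_ge0// mulr_ge0// hnorm_ge0.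
  exists (e / (2 * hnorm x + 2 * C + 1)); first by rewrite divr_gt0.
  move=> y Wy; rewrite ltr_pdivlMr// => xy.
  have phixy : - sre (phi x) + sre (phi y) <= C * hnorm (x - y).
    have := phiC (y - x) (subspaceB hW Wy Wx).
    rewrite -hnorm_opp opprB -scaleN1r addrC linphi// sreD mulN1r.
    by rewrite sreN.
  have xy0 := hnorm_ge0 (x - y).
  have sqxy : hnorm x ^+ 2 - hnorm y ^+ 2 <= 2 * hnorm x * hnorm (x - y).
    have x0 := hnorm_ge0 x; have y0 := hnorm_ge0 y.
    have : hnorm x <= hnorm y + hnorm (x - y).
      by rewrite -{1}(subrK y x) addrC ler_hnormD.
    rewrite subr_sqr => xyle; have [yx|yx] := leP (hnorm y) (hnorm x).
      by rewrite mulrC; apply: ler_pM; lra.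
    apply: (@le_trans _ _ 0); last by rewrite !mulr_ge0.
    by rewrite mulr_le0_ge0 ?addr_ge0//; lra.
  rewrite /J; lra.
(* First variation: compare [v] with [v + t w], divide by [t], and let the remainder
   [t hnorm w ^+ 2] fall below an arbitrary [d]. *)
have opt w : W w -> sre (phi w - ip w v) <= 0.
  move=> Ww; apply/ler_addgt0Pr => d d0; rewrite add0r.
  pose t := d / (hnorm w ^+ 2 + 1).
  have w1 : 0 < hnorm w ^+ 2 + 1 by rewrite ltr_wpDl// sqr_ge0.
  have t0 : 0 < t by rewrite divr_gt0.
  have := minv (v + sreal s t *: w) (subspaceD hW Wv (subspaceZ hW _ Ww)).
  rewrite /J hnorm_sqrD hnorm_scale phiD// ?phiZ//; last exact: subspaceZ.
  rewrite sre_ipC linearZl_LR sreD /= !sreM_sreal sreB.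
  have -> : smod (sreal s t) = t.
    apply: (@sreal_inj R s); rewrite -normr_sreal ger0_norm//.
    by rewrite -(sreal0 R s) sreal_le ltW.
  move=> h; have {h} : 0 <= t * (t * hnorm w ^+ 2 - 2 * (sre (phi w) - sre (ip w v))).
    by move: h; lra.
  rewrite pmulr_rge0//.
  have : t * hnorm w ^+ 2 <= d.
    rewrite /t mulrAC ler_pdivrMr// ler_pM2l// lerDl ler01//.
  by have := ltW d0; lra.
exists v => // w Ww; apply/eqP; rewrite -subr_eq0 -smod_eq0 -sqrf_eq0.
rewrite eq_le sqr_ge0 andbT -sreM_conj.
(* Scaling [w] by the conjugate of the defect [phi w - ip w v] turns the bound on a real part into:
   the squared modulus of the defect is at most 0. *)
have := opt _ (subspaceZ hW (sconj (phi w - ip w v)) Ww).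
by rewrite phiZ// linearZl_LR /= -mulrBr.
Qed.

End InnerProduct.

(** * Least squares for the analysis operator of a frame *)

Section LeastSquares.
Variables (R : realType) (s : scalar_kind).
Local Notation K := (scalar_field R s).
Variables (H : completeNormedModType K) (W : set H) (T : choiceType).
Hypothesis hW : closed_subspace W.
Variables (U : H -> T -> K) (alpha beta : R).
Hypothesis U_linear : forall (a : K) x y j, U (a *: x + y) j = a * U x j + U y j.
Hypotheses (alpha0 : 0 < alpha) (beta0 : 0 < beta).
Hypothesis U_l2 : forall w, W w -> l2 (U w).
Hypothesis U_ge : forall w, W w -> alpha * hnorm w ^+ 2 <= l2sq (U w).
Hypothesis U_le : forall w, W w -> l2sq (U w) <= beta * hnorm w ^+ 2.

Let UB x y j : U (x - y) j = U x j - U y j.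
Proof. by rewrite addrC -scaleN1r U_linear mulN1r addrC. Qed.

Let U0 j : U 0 j = 0.
Proof. by rewrite -(subrr 0) UB subrr. Qed.

Let UZ a x j : U (a *: x) j = a * U x j.
Proof. by rewrite -[a *: x]addr0 U_linear U0 addr0. Qed.

Let UD x y j : U (x + y) j = U x j + U y j.
Proof. by rewrite -{1}[x]scale1r U_linear mul1r. Qed.

(** The minimizer of the squared residual over [W]: the lower frame bound gives strong convexity,
    the upper one semicontinuity, and orthogonality of the residual is the first-order condition. *)
Lemma exists_least_squares z : l2 z ->
  exists2 w, W w & forall u, W u -> l2orth (U w \- z) (U u).
Proof.
move=> lz; pose J w := l2sq (U w \- z).
have lUz w : W w -> l2 (U w \- z).
  by move=> /U_l2 lw; have [] := l2B lw lz.
(* The parallelogram law for the residuals of [x] and [y] gives [alpha hnorm (x - y) ^+ 2 + 4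
   J(midpoint) <= 2 J x + 2 J y]; halving yields the modulus [alpha / 2]. *)
have [||||w Ww minw] := @exists_minimizer R s H W hW J (alpha / 2) 0.
- by rewrite divr_gt0.
- by move=> x _; exact: l2sq_ge0.
- move=> x y Wx Wy; have := l2sq_parallelogram (lUz x Wx) (lUz y Wy).
  have Wm := subspaceZ hW 2^-1 (subspaceD hW Wx Wy).
  have -> : (U x \- z) \+ (U y \- z) =
      fun j => 2 * (U (2^-1 *: (x + y)) \- z) j.
    apply/funext => j /=; rewrite UZ UD mulrBr mulrA mulfV ?pnatr_eq0// mul1r.
    by rewrite mulr2n mulrDl mul1r; ring.
  have -> : (U x \- z) \- (U y \- z) = U (x - y).
    by apply/funext => j /=; rewrite UB; ring.
  have -> : l2sq (fun j => 2 * (U (2^-1 *: (x + y)) \- z) j) =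
      4 * J (2^-1 *: (x + y)).
    rewrite (l2Z _ (lUz _ Wm)).2 /J; congr (_ * _).
    have h : smod (2 : K) * 2^-1 = 1.
      rewrite -(smod_half R s) -smodM mulfV ?pnatr_eq0//.
      apply: (@sreal_inj R s).
      by rewrite -normr_sreal normr1 sreal1.
    have -> : smod (2 : K) = 2.
      by apply: (mulIf (_ : 2^-1 != 0)); rewrite ?invr_eq0 ?pnatr_eq0// h mulfV ?pnatr_eq0.
    by rewrite -natrX.
  have := U_ge (subspaceB hW Wx Wy); rewrite /J; lra.
- move=> x e Wx e0.
  have J0 : 0 <= J x by exact: l2sq_ge0.
  have J1 : 0 < J x + 1 by rewrite ltr_wpDl.
  (* In [J x <= (1 + t) J y + (1 + t^-1) l2sq (U (x - y))] each excess is to be at most [e / 2]: [t]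
     controls [t J y] when [J y < J x], and [d] below controls the last term. *)
  pose t := e / (2 * (J x + 1)).
  have t0 : 0 < t by rewrite divr_gt0// mulr_gt0.
  have tJ : t * J x <= e / 2.
    rewrite /t invfM mulrA mulrAC ler_pdivrMr//.
    by rewrite ler_pM2l ?lerDl// divr_gt0.
  pose c := (1 + t^-1) * beta.
  have c0 : 0 < c by rewrite mulr_gt0// addr_gt0// invr_gt0.
  (* The cap 1 lets the squared distance be bounded by the distance. *)
  pose d := Num.min 1 (e / 2 / c).
  have d0 : 0 < d by rewrite lt_min ltr01/= !divr_gt0.
  exists d => // y Wy xy; have [//|yx] := leP (J x) (J y).
    by move=> h; apply: le_trans h _; rewrite lerDl ltW.
  have Wxy := subspaceB hW Wx Wy.
  have [_ /(_ t t0)] := l2D (lUz y Wy) (U_l2 Wxy).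
  have -> : (U y \- z) \+ U (x - y) = U x \- z.
    by apply/funext => j /=; rewrite UB; ring.
  rewrite -/(J x) -/(J y).
  have : (1 + t^-1) * l2sq (U (x - y)) <= e / 2.
    apply: (@le_trans _ _ (c * d)).
      rewrite /c -mulrA ler_wpM2l ?addr_ge0 ?invr_ge0 ?(ltW t0)//.
      apply: le_trans (U_le Wxy) _; rewrite ler_pM2l//.
      have xy0 := hnorm_ge0 (x - y).
      have xy1 : hnorm (x - y) <= 1.
        by apply: le_trans (ltW xy) _; rewrite /d ge_min lexx.
      rewrite expr2; apply: le_trans (ltW xy).
      by rewrite -[leRHS]mul1r ler_wpM2r.
    by rewrite mulrC -ler_pdivlMr// /d ge_min lexx orbT.
  have : t * J y <= t * J x by rewrite ler_pM2l// ltW.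
  lra.
exists w => // u Wu; apply: l2orth_of_min; [exact: lUz|exact: U_l2|].
move=> a; have Wau := subspaceD hW Ww (subspaceZ hW a Wu).
have := minw _ Wau; rewrite /J.
congr (_ <= _); congr l2sq; apply/funext => j /=; rewrite UD UZ; ring.
Qed.

(** * Recovery of a source from a matrix whose rows converge *)

Section Recovery.
Variables (I : Type) (G : set_system I).
Context {GF : ProperFilter G}.

(* w is the least-squares solution of U w = z, where z is the limit in l^2 of
   the rows of D. *)
Definition recovers (D : I -> T -> K) (w : H) : Prop :=
  exists z, [/\ l2 z,
    forall e : R, 0 < e -> \forall i \near G,
      l2 (D i \- z) /\ l2sq (D i \- z) <= e,
    W w & forall u, W u -> l2orth (U w \- z) (U u)].

(** Since the residual is orthogonal to [U w], Pythagoras bounds [l2sq (U w)] by [l2sq z]. Comparing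
    [z] with a nearby row, with weight 1 in [l2D], costs the factor 2. *)
Lemma recovers_bound D w b : recovers D w -> (forall i, l2sq (D i) <= b) ->
  alpha * hnorm w ^+ 2 <= 2 * b.
Proof.
move=> [z [lz zlim Ww orthz]] Db.
have lUz : l2 (U w \- z) by have [] := l2B (U_l2 Ww) lz.
have le_z : alpha * hnorm w ^+ 2 <= l2sq z.
  apply: le_trans (U_ge Ww) _.
  have o := orthz w Ww; have := l2orth_pythagoras lUz (U_l2 Ww) o; rewrite o.
  have -> : U w \- z \- U w = \- z by apply/funext => j /=; ring.
  by rewrite (l2N lz).2 => ->; rewrite lerDr l2sq_ge0.
apply: le_trans le_z _; apply/ler_addgt0Pr => e e0.
have e20 : 0 < e / 2 by rewrite divr_gt0.
have /filter_ex[i [ldi le_e]] := zlim _ e20.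
have lDi : l2 (D i).
  have := (l2D lz ldi).1; congr l2; apply/funext => j /=; ring.
have [_ /(_ 1 ltr01)] := l2D (l2N ldi).1 lDi.
have -> : (\- (D i \- z)) \+ D i = z by apply/funext => j /=; ring.
rewrite (l2N ldi).2 invr1; have := Db i; lra.
Qed.

Lemma recovers_linear D D' w w' (a : K) : recovers D w -> recovers D' w' ->
  recovers (fun i j => a * D i j + D' i j) (a *: w + w').
Proof.
move=> [z [lz zlim Ww orthz]] [z' [lz' zlim' Ww' orthz']].
have [laz _] := l2Z a lz.
exists (fun j => a * z j + z' j); split.
- by have [] := l2D laz lz'.
(* With both weights of [l2D] equal to 2, the two tolerances [e / c] and [e / 4] contribute at most
   [e / 2] each; the inner 1 keeps [c] positive when [a = 0]. *)
- move=> e e0; pose c := 2 * (2 * smod a ^+ 2 + 1).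
  have c0 : 0 < c by rewrite mulr_gt0// ltr_wpDl// mulr_ge0// sqr_ge0.
  have e1 : 0 < e / c by rewrite divr_gt0.
  have e4 : 0 < e / 4 by rewrite divr_gt0.
  apply: filterS2 (zlim _ e1) (zlim' _ e4) => i [l1 le1] [l2' le2].
  have [la Ea] := l2Z a l1.
  have -> : (fun j => a * D i j + D' i j) \- (fun j => a * z j + z' j) =
    (fun j => a * (D i \- z) j) \+ (D' i \- z').
    by apply/funext => j /=; ring.
  have [lD /(_ 1 ltr01) le_comb] := l2D la l2'; split=> //.
  apply: le_trans le_comb _; rewrite Ea invr1.
  have : smod a ^+ 2 * l2sq (D i \- z) <= smod a ^+ 2 * (e / c).
    by rewrite ler_wpM2l ?sqr_ge0.
  have : (2 * smod a ^+ 2 + 1) * (e / c) = e / 2.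
    by rewrite /c; field; rewrite gt_eqF//; move: c0; rewrite /c; lra.
  lra.
- by apply: subspaceD => //; exact: subspaceZ.
- move=> u Wu.
  have lUz : l2 (U w \- z) by have [] := l2B (U_l2 Ww) lz.
  have lUz' : l2 (U w' \- z') by have [] := l2B (U_l2 Ww') lz'.
  have -> : U (a *: w + w') \- (fun j => a * z j + z' j) =
      (fun j => a * (U w \- z) j) \+ (U w' \- z').
    by apply/funext => j /=; rewrite U_linear; ring.
  apply: l2orthD => //; [by have [] := l2Z a lUz|exact: U_l2| |exact: orthz'].
  (* The scalar moves to the test vector: [a^-1 * U u] is [U (a^-1 *: u)], and [W] is stable under
     scaling. *)
  apply: l2orthZ => //; first exact: U_l2.
  rewrite (_ : (fun j => _) = U (a^-1 *: u)); last by apply/funext => j; rewrite UZ.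
  by apply: orthz; exact: subspaceZ.
Qed.

(** By linearity [w' - w] is recovered from the zero matrix, so [recovers_bound] with [b = 0]
    applies, even if the two recoveries come with different limits [z]. *)
Lemma recovers_unique D w w' : recovers D w -> recovers D w' -> w = w'.
Proof.
move=> Dw Dw'; have := @recovers_bound _ _ 0 (recovers_linear (-1) Dw Dw').
rewrite mulr0 pmulr_rle0// => h; apply/esym/eqP; rewrite -subr_eq0.
apply/eqP/hnorm_eq0/eqP; rewrite -sqrf_eq0 eq_le sqr_ge0 andbT addrC -scaleN1r.
apply: h => i; rewrite (_ : (fun j => _) = (fun j => 0 * D i j)); last first.
  by apply/funext => j; ring.
rewrite /l2sq /rsum esum1// => j _; rewrite /sq mul0r.
have /eqP -> : smod (0 : K) == 0 by rewrite smod_eq0.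
by rewrite expr0n.
Qed.

End Recovery.
End LeastSquares.

(** * Limits along the index set and the matrix spaces *)

#[local] Instance Lambda_infty_proper (R : realType) (N r : nat) :
  ProperFilter (@Lambda_infty R N r).
Proof.
apply: filter_from_proper.
  apply: filter_from_filter; first by exists 0.
  move=> M M' _ _; exists (Num.max M M') => // l /=.
  by rewrite gt_max => /andP[].
(* An even position [2 k] of [fwd] has value [2 k]; here [k] exceeds the absolute value of [M]. *)
move=> M _; exists (fwd (Num.truncn `|M|).+1.*2).
rewrite /= /fwd_val odd_double mul0r add0r doubleK.
rewrite (le_lt_trans (ler_norm M))//.
rewrite (lt_le_trans (truncnS_gt _))// intrM mulrC -pmulrn.
by rewrite [leRHS]ger0_norm ?mulr_ge0// ler_peMr// ler1n.
Qed.

Section Matrices.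
Variables (R : realType) (s : scalar_kind) (N r : nat).
Local Notation K := (scalar_field R s).
Local Notation L := (Lambda R N r).
Implicit Types (z : L -> K) (T : L -> L -> K).

Lemma in_l2P z : in_l2 z <-> l2 z.
Proof.
split=> [|[_ h]]; last exact: poweR_lty.
by move=> h; split=> [j|]; [exact: sq_ge0|apply: lty_poweRy h; rewrite invr_neq0].
Qed.

Lemma l2normE z : l2 z -> l2norm z = (Num.sqrt (l2sq z))%:E.
Proof.
move=> lz; rewrite /l2norm (rsumE lz) poweR_EFin powR12_sqrt//.
exact: l2sq_ge0.
Qed.

Lemma l2norm_ge0 z : (0 <= l2norm z)%E.
Proof. exact: poweR_ge0. Qed.

Lemma B_norm_row T i : (l2norm (T i) <= B_norm T)%E.
Proof. by apply: ereal_sup_ubound; exists i. Qed.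

Lemma in_B_norm T : in_B T -> exists2 b : R, 0 <= b &
  B_norm T = b%:E /\ forall i, l2sq (T i) <= b ^+ 2.
Proof.
move=> [T2 Too].
have B0 : (0 <= B_norm T)%E.
  (* The row at [fwd 0] witnesses that the supremum is over a nonempty set. *)
  exact: le_trans (l2norm_ge0 _) (B_norm_row T (fwd 0)).
have [b BE] : exists b : R, B_norm T = b%:E.
  by exists (fine (B_norm T)); rewrite fineK// ge0_fin_numE.
have b0 : 0 <= b by rewrite -lee_fin -BE.
exists b; rewrite ?b0 //; split=> // i; have := B_norm_row T i.
rewrite BE l2normE ?lee_fin; last by apply/in_l2P.
move=> le; rewrite -[leLHS]sqr_sqrtr ?l2sq_ge0//.
by rewrite lerXn2r ?nnegrE ?sqrtr_ge0.
Qed.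

Lemma in_Bs_limit T : in_Bs T -> exists z, l2 z /\
  forall e : R, 0 < e -> \forall i \near @Lambda_infty R N r,
    l2 (T i \- z) /\ l2sq (T i \- z) <= e.
Proof.
move=> [[T2 _] [z /in_l2P lz Tz]]; exists z; split=> // e e0.
have e0' : (0 < (Num.sqrt e)%:E)%E by rewrite lte_fin sqrtr_gt0.
have near_small : \forall i \near @Lambda_infty R N r,
    (l2norm (fun j => (T i j - z j)%R) < (Num.sqrt e)%:E)%E.
  exact: Tz _ (open_ereal_lt' e0').
apply: filterS near_small => i.
have /in_l2P lTi := T2 i; have [lTz _] := l2B lTi lz.
by rewrite (l2normE lTz) lte_fin ltr_sqrt// => /ltW.
Qed.

(** Constant-row matrices are the data of stationary states. *)
Lemma in_Bs_const z : l2 z ->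
  in_Bs (fun _ : L => z) /\ B_norm (fun _ : L => z) = (Num.sqrt (l2sq z))%:E.
Proof.
move=> lz.
have BE : B_norm (fun _ : L => z) = (Num.sqrt (l2sq z))%:E.
  rewrite -(l2normE lz) /B_norm -[RHS]ereal_sup1; congr ereal_sup.
  by apply/seteqP; split=> [_ [i _ <-]//|_ ->]; exists (fwd 0).
split=> //; split.
  by split=> [_|]; [exact/in_l2P|rewrite BE ltry].
exists z; first exact/in_l2P.
rewrite (_ : (fun _ => _) = fun=> 0%E); last first.
  apply/funext => i; rewrite (_ : (fun _ => _) = fun j => 0 * z j); last first.
    by apply/funext => j; rewrite subrr mul0r.
  have [l0 E] := l2Z 0 lz; have /eqP E0 : smod (0 : K) == 0 by rewrite smod_eq0.
  by rewrite l2normE// E E0 expr0n mul0r sqrtr0.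
exact: cvg_cst.
Qed.

End Matrices.

(** * The adjoint of [S] and the two implications *)

Section System.
Variables (R : realType) (s : scalar_kind) (N r : nat).
Local Notation K := (scalar_field R s).
Local Notation L := (Lambda R N r).
Variables (H : completeNormedModType K) (ip : {dot H for @sconj R s}).
Hypothesis hip : forall x : H, ip x x = `|x| ^+ 2.
Variables (W : set H) (S : H -> H) (g : L -> H).
Hypotheses (hW : closed_subspace W) (hS : bounded_linear_on W S).

(** Riesz representation applied to [w |-> ip (S w) h], bounded on [W] by Cauchy-Schwarz and the
    bound of [S]; hence [xget] does not return its default. *)
Lemma adjointP (h : H) : W (adjoint ip W S h) /\
  forall w, W w -> ip (S w) h = ip w (adjoint ip W S h).
Proof.
have [Slin [C SC]] := hS.
have [a x y Wx Wy|x Wx|v Wv vE] := @riesz_subspace R s H ip hip W hW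
    (fun w => ip (S w) h) (C * hnorm h).
- by rewrite Slin// linearDl linearZl_LR.
- apply: le_trans (sre_ip_le hip _ _) _.
  by rewrite mulrAC ler_wpM2r ?hnorm_ge0// SC.
exact: (@xgetPex _ 0 [set v | W v /\ forall w, W w -> ip (S w) h = ip w v]
  (ex_intro _ v (conj Wv vE))).
Qed.

Variable beta : R.
Hypotheses (beta0 : 0 < beta) (hg : bessel ip g beta).

Lemma bessel_l2 x : l2 (fun j => ip x (g j)) /\
  l2sq (fun j => ip x (g j)) <= beta * hnorm x ^+ 2.
Proof.
have := hg x; rewrite /bessel_sum => h.
have lx : l2 (fun j => ip x (g j)).
  by split=> [j|]; [exact: sq_ge0|apply: le_lt_trans h (ltry _)].
by split=> //; move: h; rewrite (rsumE lx) lee_fin.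
Qed.

Variable F : dynamics N r H.
Hypothesis hsys : gen_nonuniform_system W F S.

Let f j := adjoint ip W S (g j).
Let U w := fun j => ip w (f j).

Let U_S w : W w -> U w = fun j => ip (S w) (g j).
Proof. by move=> Ww; apply/funext => j; rewrite (adjointP (g j)).2. Qed.

Let U_l2 w : W w -> l2 (U w).
Proof. by move=> Ww; rewrite U_S//; exact: (bessel_l2 _).1. Qed.

Let bessel_sumE w : W w -> bessel_sum ip f w = (l2sq (U w))%:E.
Proof. by move=> /U_l2 lU; rewrite -(rsumE lU). Qed.

Lemma recoverable_frame : stably_recoverable ip W F g -> frame_for ip W f.
Proof.
move=> [Rec [[_ [C RecC]] RecE]]; split=> [j|]; first exact: (adjointP _).1.
have [_ [CS SC]] := hS.
have C1 : 0 < C ^+ 2 + 1 by rewrite ltr_wpDl// sqr_ge0.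
(* The lower bound inverts the squared bound of [Rec], the upper one combines Bessel with the bound
   of [S]; adding 1 keeps both positive when [C] or [CS] is 0. *)
exists (C ^+ 2 + 1)^-1, (beta * CS ^+ 2 + 1); split.
- by rewrite invr_gt0.
- by rewrite ltr_wpDl// mulr_ge0 ?sqr_ge0// ltW.
move=> w Ww; rewrite bessel_sumE// !lee_fin; split; last first.
  rewrite U_S//; apply: le_trans (bessel_l2 _).2 _.
  apply: (@le_trans _ _ (beta * (CS ^+ 2 * hnorm w ^+ 2))).
    rewrite ler_pM2l// -exprMn lerXn2r ?nnegrE ?hnorm_ge0 ?SC//.
    by apply: le_trans (SC _ Ww); exact: hnorm_ge0.
  by rewrite mulrA mulrDl mul1r lerDl sqr_ge0.
have [sys1 sys2 _ _] := hsys.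
have [p [sp _]] := sys1 w Ww.
have DE : data_matrix ip g (fun=> average p) = fun=> U w.
  by apply/funext => i; rewrite U_S// (sys2 w p).
have := RecE _ _ _ _ Ww sp; rewrite DE => Rw.
have [Bs BE] := in_Bs_const (U_l2 Ww).
have := RecC _ Bs; rewrite Rw BE -EFinM lee_fin => le.
have q0 := l2sq_ge0 (U w).
have : hnorm w ^+ 2 <= C ^+ 2 * l2sq (U w).
  rewrite -[X in _ * X]sqr_sqrtr// -exprMn lerXn2r ?nnegrE ?hnorm_ge0//.
  (* The sign of [C] is unknown; the right-hand side is nonnegative because it dominates a norm. *)
  by apply: le_trans le; exact: hnorm_ge0.
by move=> wle; rewrite mulrC ler_pdivrMr//; lra.
Qed.

Lemma frame_recoverable : frame_for ip W f -> stably_recoverable ip W F g.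
Proof.
move=> [_ [alpha [b0 [alpha0 b00 frameU]]]].
have U_lin (a : K) x y j : U (a *: x + y) j = a * U x j + U y j.
  by rewrite /U linearDl linearZl_LR.
have U_ge w : W w -> alpha * hnorm w ^+ 2 <= l2sq (U w).
  by move=> Ww; have [] := frameU w Ww; rewrite bessel_sumE// lee_fin.
have U_le w : W w -> l2sq (U w) <= b0 * hnorm w ^+ 2.
  by move=> Ww; have [_] := frameU w Ww; rewrite bessel_sumE// lee_fin.
pose P (T : L -> L -> K) w := recovers W U (@Lambda_infty R N r) T w.
have Punique T w w' : P T w -> P T w' -> w = w'.
  exact: (@recovers_unique R s H W L hW U alpha U_lin alpha0 U_l2 U_ge _ _ _).
have Plin := @recovers_linear R s H W L hW U U_lin U_l2 _ _ _.
have Pex T : in_Bs T -> exists w, P T w.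
  move=> /in_Bs_limit[z [lz zlim]].
  have [w Ww orthw] := exists_least_squares hW U_lin alpha0 b00 U_l2 U_ge U_le lz.
  by exists w, z.
(* The default 0 is taken only at matrices from which no [w] is recovered, hence never on B^s. *)
pose Rec (T : L -> L -> K) := xget 0 [set w | P T w].
have RecP T w : P T w -> Rec T = w.
  by move=> Pw; apply: (Punique T) => //; apply: (xgetPex 0 (P := P T)); exists w.
exists Rec; split; [split|].
- move=> a T T' /Pex[w Pw] /Pex[w' Pw'].
  by rewrite (RecP _ _ Pw) (RecP _ _ Pw'); apply: RecP; exact: Plin.
- exists (Num.sqrt (2 / alpha)) => T TBs.
  have [w Pw] := Pex _ TBs; rewrite (RecP _ _ Pw).
  have [b b0' [-> le]] := in_B_norm TBs.1.
  have h : hnorm w ^+ 2 <= 2 / alpha * b ^+ 2.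
    rewrite mulrAC ler_pdivlMr// [leLHS]mulrC.
    exact: (@recovers_bound R s H W L U alpha U_l2 U_ge _ _ _ _ _ _ Pw le).
  have a20 : 0 <= 2 / alpha by rewrite divr_ge0// ltW.
  rewrite -EFinM lee_fin -(@ler_pXn2r _ 2)//.
  - by rewrite exprMn sqr_sqrtr.
  - by rewrite nnegrE hnorm_ge0.
  - by rewrite nnegrE mulr_ge0 ?sqrtr_ge0.
(* For a data matrix the limit row is [U w] itself: the Bessel bound at [x i - S w] turns
   convergence of the states into convergence of the rows, and radius [Num.sqrt (e / beta)] gives
   error [e]. The residual is then 0. *)
move=> x0 xm2 w x Ww sx; apply: RecP; exists (U w); split=> //; first exact: U_l2.
  move=> e e0; have [_ _ _ /(_ _ _ _ _ Ww sx) xS] := hsys.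
  have d0 : 0 < Num.sqrt (e / beta) by rewrite sqrtr_gt0 divr_gt0.
  have near_x : \forall i \near @Lambda_infty R N r,
    hnorm (S w - x i) < Num.sqrt (e / beta).
    exact: cvg_hnorm xS _ d0.
  apply: filterS near_x => i.
  rewrite U_S// (_ : _ \- _ = fun j => ip (x i - S w) (g j)); last first.
    by apply/funext => j; rewrite /data_matrix /= linearBl.
  have [lx le] := bessel_l2 (x i - S w).
  move=> xi; split=> //; apply: le_trans le _.
  rewrite mulrC -ler_pdivlMr// -hnorm_opp opprB.
  have eb0 : 0 <= e / beta by rewrite divr_ge0// ltW.
  rewrite -[leRHS](sqr_sqrtr eb0).
  by rewrite lerXn2r ?nnegrE ?hnorm_ge0 ?sqrtr_ge0// ltW.
move=> u Wu; rewrite /l2orth.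
have [lN EN] := l2N (U_l2 Wu); rewrite (_ : _ \- _ \- _ = \- U u).
  by rewrite EN; congr l2sq; apply/funext => j /=; rewrite subrr add0r.
by apply/funext => j /=; rewrite subrr sub0r.
Qed.

End System.

Theorem theorem3p19 (R : realType) (s : scalar_kind) (N r : nat)
  (hN : (1 <= N)%N) (hodd : odd r) (hcop : coprime r N)
  (hr : (1 <= r <= 2 * N - 1)%N)
  (H : completeNormedModType (scalar_field R s)) (ip : {dot H for @sconj R s})
  (hip : forall x : H, ip x x = `|x| ^+ 2)
  (hinf : infinite_dimensional H) (hsep : separable_space H)
  (g : Lambda R N r -> H) (beta : R) (hbeta : 0 < beta)
  (hg : bessel ip g beta)
  (W : set H) (hW : closed_subspace W)
  (F : dynamics N r H) (S : H -> H)
  (hsys : gen_nonuniform_system W F S)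
  (hF : linear_dynamics W F) :
  stably_recoverable ip W F g <->
  frame_for ip W (fun j => adjoint ip W S (g j)).
Proof.
have hS : bounded_linear_on W S by case: hsys.
split; [exact (recoverable_frame hip hW hS hbeta hg hsys)|
        exact (frame_recoverable hip hW hS hbeta hg hsys)].
Qed.
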